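(* Let $F\colon X\to Y$ be a multivalued mapping of a paracompact $C$-space $X$ to a topological space $Y$. If $F$ admits an infinite stably $X$-connected filtration $\{F_i\}_{i\ge 0}$ of multivalued mappings $F_i\colon X\to Y$, then $F$ has a singlevalued continuous selection, i.e. there is a continuous map $f\colon X\to Y$ with $f(x)\in F(x)$ for every $x\in X$.
   Context: A multivalued mapping $F\colon X\to Y$ assigns to each $x\in X$ a nonempty subset $F(x)\subset Y$; for $S\subset X$, $F(S)=\bigcup_{x\in S}F(x)$; $F\subset H$ means $F(x)\subset H(x)$ for all $x\in X$. A topological space $X$ is a $C$-space if for each sequence $\{\omega_i\}_{i\ge 1}$ of open covers of $X$ there is an open cover $\Sigma$ of $X$ of the form $\Sigma=\bigcup_{i=1}^\infty \sigma_i$ such that for each $i\ge 1$, $\sigma_i$ is a pairwise disjoint collection which refines $\omega_i$ (each element of $\sigma_i$ is contained in some element of $\omega_i$). A sequence of multivalued mappings $\{F_i\colon X\to Y\}$ is a filtration of a multivalued mapping $F\colon X\to Y$ if for every $x\in X$ the sets $F_i(x)$ form an increasing sequence $F_0(x)\subset F_1(x)\subset\dots\subset F(x)$ of subspaces of $F(x)$. For a space $Z$, a pair of spaces $V\subset U$ is $Z$-connected if for every closed subspace $A\subset Z$ any (continuous) mapping of $A$ into $V$ can be extended to a mapping of $Z$ into $U$. A pair $F\subset H$ of multivalued mappings from $X$ to $Y$ is stably $Z$-connected if every point $x\in X$ has a neighborhood $O_x$ such that the pair $F(O_x)\subset \bigcap_{z\in O_x} H(z)$ is $Z$-connected. (In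 particular this includes the inclusion $F(O_x)\subset \bigcap_{z\in O_x} H(z)$.) A filtration $\{F_i\}$ of multivalued mappings is stably $Z$-connected if every pair $F_i\subset F_{i+1}$ is stably $Z$-connected. Here these notions are used with $Z=X$. *)

(* Defs.v *)
From mathcomp Require Import all_boot all_classical topology.

Set Implicit Arguments.
Unset Strict Implicit.
Unset Printing Implicit Defensive.

Local Open Scope classical_set_scope.

(* Collections of subsets are sets of sets, not indexed families. *)
Definition open_cover (X : topologicalType) (w : set (set X)) : Prop :=
  (forall W, w W -> open W) /\ \bigcup_(W in w) W = [set: X].

Definition refines (X : Type) (s w : set (set X)) : Prop :=
  forall S, s S -> exists2 W, w W & S `<=` W.

Definition locally_finite (X : topologicalType) (s : set (set X)) : Prop :=
  forall x : X, exists2 O, nbhs x O & finite_set [set S | s S /\ S `&` O !=set0].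

(* As is customary (e.g. Engelking), paracompact spaces are Hausdorff. *)
Definition paracompact (X : topologicalType) : Prop :=
  hausdorff_space X /\
  forall w : set (set X), open_cover w ->
    exists s, [/\ open_cover s, refines s w & locally_finite s].

(* Sequences are indexed from 0. *)
Definition C_space (X : topologicalType) : Prop :=
  forall w : nat -> set (set X), (forall i, open_cover (w i)) ->
    exists s : nat -> set (set X),
      [/\ open_cover (\bigcup_i s i),
          forall i, trivIset (s i) id
        & forall i, refines (s i) (w i)].

Definition multivalued (X Y : Type) (F : X -> set Y) : Prop :=
  forall x, F x !=set0.

Definition mv_sub (X Y : Type) (F H : X -> set Y) : Prop :=
  forall x, F x `<=` H x.

Definition filtration (X Y : Type) (Fi : nat -> X -> set Y) (F : X -> set Y) :
    Prop :=
  [/\ forall i, multivalued (Fi i),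
      forall i, mv_sub (Fi i) (Fi i.+1)
    & forall i, mv_sub (Fi i) F].

(* A, V and U are coerced to types carrying the subspace topology. *)
Definition connected_pair (Z Y : topologicalType) (V U : set Y) : Prop :=
  V `<=` U /\
  forall A : set Z, closed A -> forall f : A -> V, continuous f ->
    exists2 g : Z -> U, continuous g &
      forall a : A, set_val (g (set_val a)) = set_val (f a).

Definition stably_connected_pair (Z X Y : topologicalType)
    (F H : X -> set Y) : Prop :=
  mv_sub F H /\
  forall x : X, exists2 O : set X, nbhs x O &
    connected_pair Z (\bigcup_(z in O) F z) (\bigcap_(z in O) H z).

Definition stably_connected (Z X Y : topologicalType)
    (Fi : nat -> X -> set Y) : Prop :=
  forall i, stably_connected_pair Z (Fi i) (Fi i.+1).

(* Main.v *)
(** The C-property, applied to covers by sets that witness the stable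
connectedness of the pairs [Fi i], [Fi i.+1], gives disjoint open families [s
i] whose unions [U i] cover [X]. Paracompactness provides closed sets [K i]
inside [U i] such that the finite unions [C n] of the [K i], [i < n], have
interiors covering [X]. A map on [C n] selecting from [Fi n] extends over [C
n.+1]: [K n] is a discrete union of its closed pieces [K n `&` S] with [S] in
[s n], and on each piece the connectedness of the pair gives an extension
which selects from [Fi n.+1]. The union of these maps is the selection. *)
Require Import Defs.
From mathcomp Require Import all_boot all_classical topology.

Set Implicit Arguments.
Unset Strict Implicit.
Unset Printing Implicit Defensive.

Local Open Scope classical_set_scope.

(** Near a given point only finitely many members of [t] matter, and a finite union of closed sets
    is closed. *)
Lemma closed_bigcup_closure (X : topologicalType) (s t : set (set X)) :
  locally_finite s -> t `<=` s -> closed (\bigcup_(S in t) closure S).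
Proof.
move=> lfs ts x clx; have [O nO finO] := lfs x.
pose D := t `&` [set S | s S /\ S `&` O !=set0].
have finD : finite_set D by apply: sub_finite_set finO => S [].
suff [S [tS _] Sx] : (\bigcup_(S in D) closure S) x by exists S.
apply: (closed_bigcup (T := X) finD); first by move=> S _; exact: closed_closure.
move=> B nB; have [z [[S tS Sz] [Bz Oz]]] := clx _ (filterI nB (nbhs_interior nO)).
exists z; split=> //; exists S => //; split=> //; split; first exact: ts.
exact: Sz.
Qed.

Lemma paracompact_regular (X : topologicalType) :
  paracompact X -> regular_space X.
Proof.
move=> [hX pX] x B Ux; pose U := B°.
have [oU UB] : open U /\ U `<=` B.
  by split; [exact: open_interior | exact: interior_subset].
(* [w] covers [X] by the Hausdorff property. A member of a refinement whose closure contains [x]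
   must lie in [U], so the remaining members, collected in [t], cover the complement of [U]. *)
pose w := [set U] `|` [set W | open W /\ ~ closure W x].
have [|s [[os cs] rs lfs]] := pX w.
  split; first by move=> W [->|[]].
  rewrite -subTset => y _.
  have [Uy|Uy] := pselect (U y); first by exists U => //; left.
  have xy : x != y by apply/eqP => xy; apply: Uy; rewrite -xy.
  move: hX; rewrite open_hausdorff => /(_ _ _ xy) [[P Q] /= []].
  rewrite !inE => Px Qy [oP oQ PQ]; exists Q => //; right; split=> //.
  move=> /(_ P (open_nbhs_nbhs (conj oP Px))) [z [Qz Pz]].
  by rewrite -[False]/((@set0 X) z) -PQ.
pose t := s `&` [set S | ~ closure S x].
pose V := \bigcup_(S in t) S.
have cV : closed (\bigcup_(S in t) closure S).
  by apply: (closed_bigcup_closure lfs) => S [].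
have oV : open V by apply: bigcup_open => S [sS _]; exact: os.
have VU : ~` V `<=` U.
  move=> y Vy; have [S sS Sy] : (\bigcup_(S in s) S) y by rewrite cs.
  have [W [WE|[oW Wx]] SW] := rs _ sS; first by rewrite -WE; exact: SW.
  case: Vy; exists S => //; split=> // Sx; apply: Wx; exact: closureS SW _ Sx.
exists (~` \bigcup_(S in t) closure S).
  apply: open_nbhs_nbhs; split; first exact: closed_openC.
  by case=> S [].
apply: subset_trans UB; apply: subset_trans VU.
move: (open_closedC oV) => /closure_id ->.
apply: closureS; apply: subsetC; apply: subset_bigcup => S _.
exact: subset_closure.
Qed.

(** By regularity, the open sets with closure inside some [U i] cover [X]. In a locally finite
    refinement, the closures that fit inside [U i] are united into [K i]. *)
Lemma paracompact_closed_exhaustion (X : topologicalType) (U : nat -> set X) :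
    paracompact X -> (forall i, open (U i)) -> \bigcup_i U i = [set: X] ->
  exists K : nat -> set X,
    [/\ forall i, closed (K i), forall i, K i `<=` U i
      & forall x : X, exists n, nbhs x (\bigcup_(i in `I_n) K i)].
Proof.
move=> pX oU cU; have rX := paracompact_regular pX; have [_ {}pX] := pX.
have [|s [[os cs] rs lfs]] :=
    pX [set W | open W /\ exists i, closure W `<=` U i].
  split; first by move=> W [].
  rewrite -subTset => x _; have [i _ Uix] : (\bigcup_i U i) x by rewrite cU.
  have [W nW WU] := rX x _ (open_nbhs_nbhs (conj (oU i) Uix)).
  exists W°; last by [].
  split; first exact: open_interior.
  by exists i; apply: subset_trans WU; apply: closureS; exact: interior_subset.
pose t i := s `&` [set S | closure S `<=` U i].
have /choice [i iP] : forall S, exists i, s S -> closure S `<=` U i.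
  move=> S; have [sS|?] := pselect (s S); last by exists 0.
  have [W [_ [i WU]] SW] := rs _ sS; exists i => _.
  exact: subset_trans (closureS SW) WU.
exists (fun i => \bigcup_(S in t i) closure S); split.
- by move=> j; apply: (closed_bigcup_closure lfs) => S [].
- by move=> j x [S [_ SU]] /SU.
move=> x; have [O nO finO] := lfs x.
have /finite_seqP [l lE] := finite_image i finO.
(* [l] lists the indices chosen for the finitely many members meeting [O]; the successor is needed
   because [I_n] is strict. *)
exists (\max_(j <- l) j).+1; apply: filterS nO => y Oy.
have [S sS Sy] : (\bigcup_(S in s) S) y by rewrite cs.
exists (i S); last by exists S; [split => //; exact: iP | exact: subset_closure].
rewrite /= ltnS; apply: leq_bigmax_seq => //.
have : (i @` [set S | s S /\ S `&` O !=set0]) (i S).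
  by exists S => //; split=> //; exists y.
by rewrite lE.
Qed.

Lemma within_continuous_local (X Y : topologicalType) (K : set X) (f : X -> Y) :
    (forall x, K x -> exists U (g : X -> Y),
      [/\ nbhs x U, {within K `&` U, continuous g}
        & {in K `&` U, f =1 g}]) ->
  {within K, continuous f}.
Proof.
move=> loc; apply/subspace_continuousP => x Kx.
have [U [g [nU /subspace_continuousP cg fg]]] := loc x Kx.
have Ux := nbhs_singleton nU.
have fgx : f x = g x by apply: fg; rewrite inE.
move=> W nfW; have nW : nbhs (g x) W by rewrite -fgx.
move: (cg x (conj Kx Ux) W nW) => nbW.
apply: filterS2 nU nbW => y Uy Wy Ky.
have fgy : f y = g y by apply: fg; rewrite inE.
by move: (Wy (conj Ky Uy)); rewrite /preimage /= /from_subspace fgy.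
Qed.

(** Restates the extension property for total functions into [Y], which can be glued without
    handling subtypes. *)
Lemma connected_pair_extension (Z Y : topologicalType) (V U : set Y)
    (A : set Z) (f : Z -> Y) :
    connected_pair Z V U -> closed A -> {within A, continuous f} ->
    f @` A `<=` V ->
  exists g : Z -> Y,
    [/\ continuous g, forall z, U (g z) & {in A, f =1 g}].
Proof.
move=> [_ ext] cA /subspace_sigL_continuousP cf fAV.
have fV (a : A) : f (set_val a) \in V.
  by apply/mem_set/fAV; exists (set_val a) => //; exact: set_valP.
pose f' (a : A) : V := exist (fun y => y \in V) _ (fV a).
have cf' : continuous f'.
  apply: (@continuous_comp_initial V A Y set_val f').
  exact: cf.
have [g cg gf] := ext A cA f' cf'.
exists (set_val \o g); split.
- move=> z; apply: continuous_comp; first exact: cg.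
  exact: (@initial_continuous U Y set_val).
- by move=> z; exact: set_valP.
- by move=> a Aa; rewrite /= (gf (exist _ a Aa)).
Qed.

Lemma selection_step (X Y : topologicalType) (G H : X -> set Y)
    (s : set (set X)) (C K : set X) (f : X -> Y) :
    mv_sub G H -> (forall S, s S -> open S) -> trivIset s id ->
    refines s [set O | connected_pair X (\bigcup_(z in O) G z)
                                        (\bigcap_(z in O) H z)] ->
    closed C -> closed K -> K `<=` \bigcup_(S in s) S ->
    {within C, continuous f} -> (forall x, C x -> G x (f x)) ->
  exists f' : X -> Y,
    [/\ {within C `|` K, continuous f'},
        forall x, (C `|` K) x -> H x (f' x) & {in C, f =1 f'}].
Proof.
move=> GH os ds rs cC cK Ks cf Gf.
have cKS S : s S -> closed (K `&` S).
  (* Since [s] is disjoint and covers [K], the piece in [S] is what remains of [K] after removing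
     the other open members. *)
  move=> sS; have -> : K `&` S = K `&` ~` \bigcup_(T in s `\ S) T.
    apply/seteqP; split=> x [Kx Sx]; split=> //.
      by move=> [T [sT /= TS] Tx]; apply: TS; apply: ds => //; exists x.
    have [T sT Tx] := Ks _ Kx.
    have [<-//|TS] := pselect (T = S).
    by case: Sx; exists T.
  by apply: closedI => //; apply: open_closedC; apply: bigcup_open => T [/os].
have /choice [g gP] : forall S, exists g : X -> Y, s S ->
    [/\ continuous g, forall x, S x -> H x (g x) & {in C `&` (K `&` S), f =1 g}].
  move=> S; have [sS|?] := pselect (s S); last by exists f.
  have [O cpO SO] := rs _ sS.
  have [||//|g [cg Hg fg]] :=
      @connected_pair_extension X Y _ _ (C `&` (K `&` S)) f cpO.
  - exact: closedI cC (cKS _ sS).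
  - by apply: continuous_subspaceW cf => x [].
  - by move=> _ [x [Cx [_ Sx]] <-]; exists x; [exact: SO | exact: Gf].
  by exists g => _; split=> // x Sx; apply: Hg; exact: SO.
(* By disjointness [p x] is the only member containing [x], so [p] is constant on each piece and the
   maps [g S] glue along [K]. *)
have /choice [p pP] : forall x, exists S, K x -> s S /\ S x.
  move=> x; have [Kx|?] := pselect (K x); last by exists set0.
  by have [S sS Sx] := Ks _ Kx; exists S.
pose f' x := if x \in C then f x else g (p x) x.
have f'C : {in C, f =1 f'} by move=> x Cx; rewrite /f' Cx.
have f'K x : K x -> f' x = g (p x) x.
  move=> Kx; rewrite /f'; case: ifPn => // /set_mem Cx.
  have [sp px] := pP _ Kx; have [_ _] := gP _ sp.
  by apply; rewrite inE.
exists f'; split=> //.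
  apply: withinU_continuous => //; first exact: subspace_eq_continuous f'C cf.
  apply: within_continuous_local => x Kx; have [sp px] := pP _ Kx.
  have [cg _ _] := gP _ sp.
  exists (p x), (g (p x)); split.
  - by apply: open_nbhs_nbhs; split=> //; exact: os.
  - exact: continuous_subspaceT.
  - move=> y; rewrite inE => -[Ky pxy]; rewrite f'K //.
    have [sy py] := pP _ Ky.
    by rewrite (ds (p y) (p x) sy sp) //; exists y.
move=> x [Cx|Kx]; first by rewrite -f'C ?inE//; apply: GH; exact: Gf.
by rewrite f'K//; have [sp px] := pP _ Kx; have [_ Hg _] := gP _ sp; exact: Hg.
Qed.

Theorem theorem2p8 (X Y : topologicalType) (F : X -> set Y)
    (hX : paracompact X) (cX : C_space X) (mF : multivalued F)
    (hF : exists Fi : nat -> X -> set Y,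
        filtration Fi F /\ stably_connected X Fi) :
  exists f : X -> Y, continuous f /\ forall x, F x (f x).
Proof.
have [Fi [[_ FiS FiF] scF]] := hF.
pose cp i : set (set X) :=
  [set O | connected_pair X (\bigcup_(z in O) Fi i z)
                            (\bigcap_(z in O) Fi i.+1 z)].
(* Passing to open subsets is needed because the neighbourhoods witnessing connectedness may fail to
   be open. *)
pose w i := [set W | open W /\ exists2 O, cp i O & W `<=` O].
have [|s [[os cs] ds rs]] := cX w.
  move=> i; split; first by move=> W [].
  rewrite -subTset => x _; have [_ /(_ x) [O nO cpO]] := scF i.
  exists O°; last by [].
  by split; [exact: open_interior | exists O => //; exact: interior_subset].
have oS i S : s i S -> open S by move=> sS; apply: os; exists i.
have rcp i : refines (s i) (cp i).
  move=> S /rs [W [_ [O cpO WO]] SW].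
  by exists O => //; exact: subset_trans WO.
pose U i := \bigcup_(S in s i) S.
have [||K [cK KU KX]] := @paracompact_closed_exhaustion X U hX.
- by move=> i; apply: bigcup_open => S; exact: oS.
- rewrite -subTset => x _.
  have [S [i _ sS] Sx] : (\bigcup_(W in \bigcup_i s i) W) x by rewrite cs.
  by exists i => //; exists S.
pose C n := \bigcup_(i in `I_n) K i.
have CS n : C n.+1 = C n `|` K n by rewrite /C IIS bigcup_setU bigcup_set1.
have cC n : closed (C n) by apply: closed_bigcup => // i _; exact: finite_II.
pose good n f := {within C n, continuous f} /\ forall x, C n x -> Fi n x (f x).
have /choice [f0 _] := mF.
(* The stage [n] is stored with the map, since dependent choice iterates a relation on one fixed
   type. *)
have step (nf : {nf : nat * (X -> Y) | good nf.1 nf.2}) :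
    {nf' : {nf : nat * (X -> Y) | good nf.1 nf.2} |
      (sval nf').1 = (sval nf).1.+1 /\
      {in C (sval nf).1, (sval nf).2 =1 (sval nf').2}}.
  case: nf => -[n f] /= [cf Ff]; apply: cid.
  have [f' [cf' Ff' ff']] := selection_step (FiS n) (@oS n) (ds n) (rcp n)
    (cC n) (cK n) (KU n) cf Ff.
  by rewrite -CS in cf' Ff'; exists (exist _ (n.+1, f') (conj cf' Ff')).
(* [C 0] is empty, so any starting map will do. *)
have good0 : good 0 f0.
  by rewrite /good /C II0 bigcup_set0; split=> //; exact: continuous_subspace0.
have [h [h0 hS]] := dependent_choice step (exist _ (0, f0) good0).
pose f n := (sval (h n)).2.
have hn n : (sval (h n)).1 = n by elim: n => [|n IH]; rewrite ?h0 ?(hS n).1 ?IH.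
have fgood n : good n (f n) by move: (svalP (h n)); rewrite hn.
have fS n x : C n x -> f n.+1 x = f n x.
  by move=> Cx; rewrite /f -(hS n).2 ?hn ?inE.
have fle m n x : (m <= n)%N -> C m x -> f n x = f m x.
  move=> /subnK <- Cx; elim: (n - m)%N => [//|k IH]; rewrite addSn fS //.
  by case: Cx => j jm Kj; exists j => //; apply: leq_trans jm (leq_addl _ _).
(* The limit map takes at [x] the value of stage [n x]. On the neighbourhood [C (n x)] of [x] it
   coincides with the single map [f (n x)], because later stages never change earlier values. *)
have /choice [n nP] := KX.
have nC x : C (n x) x := nbhs_singleton (nP x).
have fE x m : C m x -> f (n x) x = f m x.
  move=> Cx; have [le|/ltnW le] := leqP (n x) m; first by rewrite (fle _ _ _ le).
  by rewrite (fle _ _ _ le).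
exists (fun x => f (n x) x); split; last first.
  by move=> x; apply: (FiF (n x)); apply: (fgood (n x)).2.
apply/continuous_subspace_setT; apply: within_continuous_local => x _.
exists (C (n x)), (f (n x)); split; first exact: nP.
- by rewrite setTI; exact: (fgood _).1.
- by move=> y; rewrite inE => -[_ Cy]; exact: fE.
Qed.
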